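(* Let $d_{\mathrm S}\ge 2$ and $d_{\mathrm B}\ge1$ be integers, let $\mathcal H_{\mathrm S}$ and $\mathcal H_{\mathrm B}$ be complex Hilbert spaces of dimension $d_{\mathrm S}$ and $d_{\mathrm B}$ respectively, and let $\epsilon>0$. Let $\rho_{\mathrm B}$ be a density matrix on $\mathcal H_{\mathrm B}$ having (at least) $\lceil d_{\mathrm B}(d_{\mathrm S}-1)/d_{\mathrm S}\rceil$ eigenvalues, counted with multiplicity, below $\epsilon/(2d_{\mathrm B}(d_{\mathrm S}-1))$. Then for every density matrix $\rho_{\mathrm S}$ on $\mathcal H_{\mathrm S}$ there exists $U\in\mathrm{SU}(d_{\mathrm S}d_{\mathrm B})$ acting on $\mathcal H_{\mathrm S}\otimes\mathcal H_{\mathrm B}$ such that $$1-\mathrm{tr}\{\rho_{\mathrm S}'^{\,2}\}\le\epsilon,\qquad \rho_{\mathrm S}'=\mathrm{tr}_{\mathrm B}\{U(\rho_{\mathrm S}\otimes\rho_{\mathrm B})U^\dagger\}.$$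
   Context: A density matrix is a positive semidefinite operator of trace one. $\mathrm{tr}_{\mathrm B}$ denotes the partial trace over $\mathcal H_{\mathrm B}$. *)

(* Defs.v *)
From HB Require Import structures.
From mathcomp Require Import all_boot all_order all_algebra.
From mathcomp Require Import complex mxtens.
From mathcomp Require Import reals.

Set Implicit Arguments.
Unset Strict Implicit.
Unset Printing Implicit Defensive.

Import Order.TTheory GRing.Theory Num.Theory.

Local Open Scope ring_scope.
Local Open Scope sesquilinear_scope.

(* A d-dimensional Hilbert space is C^d with its standard inner product, and   *)
(* operators are their matrices in the standard basis. The tensor product of   *)
(* C^m and C^n is C^(m * n), where the basis vector e_i (x) e_k has index      *)
(* mxtens_index (i, k), so that A (x) B is the Kronecker product A *t B.       *)

Section Definitions.

Variable C : numClosedFieldType.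

(* In the order of C, 0 <= z means that z is real and nonnegative. *)
Definition possemidefmx n (A : 'M[C]_n) : Prop :=
  A \is hermsymmx /\ forall v : 'cV[C]_n, 0 <= (v^t* *m A *m v) 0 0.

Definition density_matrix n (A : 'M[C]_n) : Prop :=
  possemidefmx A /\ \tr A = 1.

(* Each eigenvalue occurs with its algebraic multiplicity. *)
Definition eigenvalues n (A : 'M[C]_n) : seq C :=
  sval (closed_field_poly_normal (char_poly A)).

Lemma char_poly_eigenvalues n (A : 'M[C]_n) :
  char_poly A = \prod_(a <- eigenvalues A) ('X - a%:P).
Proof.
rewrite /eigenvalues; case: closed_field_poly_normal => s /= {1}->.
by rewrite (monicP (char_poly_monic A)) scale1r.
Qed.

Definition special_unitary n (U : 'M[C]_n) : Prop :=
  U \is unitarymx /\ \det U = 1.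

(* The partial trace over the second tensor factor. *)
Definition ptrace2 m n (A : 'M[C]_(m * n)) : 'M[C]_m :=
  \matrix_(i, j) \sum_(k < n) A (mxtens_index (i, k)) (mxtens_index (j, k)).

Lemma ptrace2_tens m n (A : 'M[C]_m) (B : 'M[C]_n) :
  ptrace2 (A *t B) = \tr B *: A.
Proof.
apply/matrixP => i j; rewrite !mxE mulr_suml.
by apply: eq_bigr => k _; rewrite tensmxE mulrC.
Qed.

End Definitions.

(* Main.v *)
Require Import Defs.
From HB Require Import structures.
From mathcomp Require Import all_boot all_order all_algebra all_fingroup.
From mathcomp Require Import complex mxtens.
From mathcomp Require Import reals.
From mathcomp Require Import ring lra.

Set Implicit Arguments.
Unset Strict Implicit.
Unset Printing Implicit Defensive.

Import Order.TTheory GRing.Theory Num.Theory.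

Local Open Scope ring_scope.
Local Open Scope sesquilinear_scope.

(* Diagonalise both states: rhoS (x) rhoB has eigenvalues p_i q_k.  The count of
   small q_k says that at most dB of these products involve a q_k that is
   not small, so a permutation of the eigenbasis moves all of them into the block
   |0><0| (x) 1, which has room for dB.  The reduced state is then diagonal, and
   its population outside |0> is a sum of (dS - 1) dB products p_i q_k <= q_k with
   q_k small, hence at most eps / 2.  Since 1 - r^2 <= 2 (1 - r), the linear
   entropy is at most eps.  A scalar phase makes the unitary special. *)

(** List [T] as [A] followed by its complement, and again as [B] followed by its complement.
    Matching the two lists place by place sends [A] into the first [#|A|] places of the second list,
    all of which lie in [B]. *)
Lemma perm_subset (T : finType) (A B : {set T}) :
  (#|A| <= #|B|)%N -> exists s : {perm T}, {in A, forall x, s x \in B}.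
Proof.
pose e (D : {set T}) := enum D ++ enum (~: D).
have mem_e D x : x \in e D.
  by rewrite mem_cat !mem_enum in_setC; case: (x \in D).
have uniq_e D : uniq (e D).
  rewrite cat_uniq !enum_uniq andbT /=; apply/hasPn => x.
  by rewrite !mem_enum in_setC.
have size_e D : size (e D) = #|T| by rewrite size_cat -!cardE cardsC.
move=> leAB.
pose f x := nth x (e B) (index x (e A)).
have ltf x : (index x (e A) < size (e B))%N by rewrite size_e -(size_e A) index_mem.
have f_inj : injective f.
  (* The default in [f x] is [x] itself; the index is in range, so it may be changed to [y] to give
     both lookups the same default. *)
  move=> x y; rewrite /f (set_nth_default y) // => /eqP.
  rewrite nth_uniq // => /eqP eq_i.
  by rewrite -(nth_index x (mem_e A x)) eq_i nth_index.
exists (perm f_inj) => x Ax; rewrite permE /f.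
have lt_xA : (index x (e A) < #|A|)%N.
  by rewrite index_cat mem_enum Ax cardE index_mem mem_enum.
rewrite nth_cat -cardE (leq_trans lt_xA leAB) -mem_enum mem_nth //.
by rewrite -cardE (leq_trans lt_xA).
Qed.

Section Matrices.

Variable C : numClosedFieldType.

Lemma norm_det_unitarymx n (U : 'M[C]_n) : U \is unitarymx -> `|\det U| = 1.
Proof.
move=> /unitarymxP/(congr1 (fun A : 'M_n => \det A)).
rewrite det_mulmx det_map_mx det_tr det1 -normCK => /eqP.
by rewrite sqrp_eq1 ?normr_ge0 // => /eqP.
Qed.

Lemma scale_unitarymx m n (c : C) (U : 'M[C]_(m, n)) :
  `|c| = 1 -> U \is unitarymx -> c *: U \is unitarymx.
Proof.
move=> c1 /unitarymxP UU; apply/unitarymxP.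
rewrite linearZ /= map_mxZ -scalemxAl -scalemxAr scalerA UU.
by rewrite -normCK c1 expr1n scale1r.
Qed.

(** Scaling by [c] multiplies the determinant by [c ^+ n], so the inverse of an [n]-th root of
    [\det U] corrects it; its modulus is 1 because that of [\det U] is. *)
Lemma special_unitary_phase n (U : 'M[C]_n) : (0 < n)%N -> U \is unitarymx ->
  exists2 c : C, `|c| = 1 & special_unitary (c *: U).
Proof.
move=> n_gt0 Uu; have detU := norm_det_unitarymx Uu.
exists (n.-root (\det U))^-1.
  by rewrite normfV norm_rootC detU rootC1 // invr1.
split.
  by apply: scale_unitarymx => //; rewrite normfV norm_rootC detU rootC1 // invr1.
by rewrite detZ exprVn rootCK // mulVf // -normr_gt0 detU.
Qed.

Lemma scale_conj_unitary n (c : C) (U A : 'M[C]_n) : `|c| = 1 ->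
  (c *: U) *m A *m (c *: U)^t* = U *m A *m U^t*.
Proof.
move=> c1; rewrite linearZ /= map_mxZ -!scalemxAl -scalemxAr scalerA.
by rewrite -normCK c1 expr1n scale1r.
Qed.

Lemma tens_unitarymx m n (U : 'M[C]_m) (V : 'M[C]_n) :
  U \is unitarymx -> V \is unitarymx -> U *t V \is unitarymx.
Proof.
move=> /unitarymxP UU /unitarymxP VV; apply/unitarymxP.
rewrite trmx_tens map_mxT tensmx_mul UU VV.
apply/matrixP => x y; case: (mxtens_indexP x) => i k; case: (mxtens_indexP y) => j l.
rewrite tensmxE !mxE (can_eq (@mxtens_indexK m n)) xpair_eqE.
by case: (i == j); case: (k == l); rewrite ?mulr1 ?mulr0 ?mul0r.
Qed.

Lemma perm_mx_unitary n (s : 'S_n) : perm_mx s \is @unitarymx C n n.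
Proof.
apply/unitarymxP; rewrite tr_perm_mx map_perm_mx -perm_mxM mulgV.
exact: perm_mx1.
Qed.

(** Row [i] of [perm_mx s] is the basis vector of index [s i], so entries are read through [s];
    moving the entry at [x] to place [s x] therefore takes [perm_mx s^-1]. *)
Lemma conj_perm_mx_diag n (s : 'S_n) (w : 'rV[C]_n) :
  perm_mx s *m diag_mx w *m (perm_mx s)^t* = diag_mx (\row_i w 0 (s i)).
Proof.
rewrite tr_perm_mx map_perm_mx -row_permE -col_permE.
apply/matrixP => i j; rewrite !mxE.
by rewrite (inj_eq perm_inj).
Qed.

Lemma tens_diag_mx m n (d : 'rV[C]_m) (e : 'rV[C]_n) :
  diag_mx d *t diag_mx e =
  diag_mx (\row_x (d 0 (mxtens_unindex x).1 * e 0 (mxtens_unindex x).2)).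
Proof.
apply/matrixP => x y; case: (mxtens_indexP x) => i k; case: (mxtens_indexP y) => j l.
rewrite tensmxE !mxE !mxtens_indexK /= (can_eq (@mxtens_indexK m n)) xpair_eqE.
by case: (i == j); case: (k == l); rewrite ?mulr1n ?mulr0n ?mulr0 ?mul0r.
Qed.

Lemma ptrace2_diag m n (w : 'rV[C]_(m * n)) :
  ptrace2 (diag_mx w) = diag_mx (\row_i \sum_k w 0 (mxtens_index (i, k))).
Proof.
apply/matrixP => i j; rewrite !mxE -sumrMnl; apply: eq_bigr => k _.
by rewrite !mxE (can_eq (@mxtens_indexK m n)) xpair_eqE eqxx andbT.
Qed.

(** The constant matrices factor out of ['X - A] because scalar matrices are central, and their
    determinants cancel. *)
Lemma char_poly_conj (F : fieldType) n (P A : 'M[F]_n) : P \in unitmx ->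
  char_poly (invmx P *m A *m P) = char_poly A.
Proof.
move=> Pu; rewrite /char_poly.
have -> : char_poly_mx (invmx P *m A *m P) =
    map_mx polyC (invmx P) *m char_poly_mx A *m map_mx polyC P.
  rewrite /char_poly_mx mulmxBr mulmxBl -!map_mxM; congr (_ - _).
  by rewrite scalar_mxC -mulmxA -map_mxM mulVmx // map_mx1 mulmx1.
rewrite !det_mulmx mulrAC -det_mulmx -map_mxM mulVmx //.
by rewrite map_mx1 det1 mul1r.
Qed.

(** Links [eigenvalues], defined through the characteristic polynomial, to an indexed diagonal, so
    that counting eigenvalues becomes counting indices. *)
Lemma density_matrix_spectral n (A : 'M[C]_n) : density_matrix A ->
  exists P d, [/\ P \is unitarymx, P *m A *m P^t* = diag_mx d,
    forall i, 0 <= d 0 i, \sum_i d 0 i = 1 &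
    perm_eq (eigenvalues A) [seq d 0 i | i <- enum 'I_n]].
Proof.
move=> [[Aherm Apos] trA].
have Pu := spectral_unitarymx A.
have /hermitian_normalmx/orthomx_spectralP := Aherm.
move: (spectralmx A) (spectral_diag A) Pu => P d Pu A_E.
have P_unit := unitarymx_unit Pu.
have PAP : P *m A *m P^t* = diag_mx d.
  rewrite -invmx_unitary // A_E !mulmxA mulmxV // mul1mx.
  by rewrite -mulmxA mulmxV // mulmx1.
exists P, d; split=> //.
(* The test vector is the adjoint of row [i] of [P], an eigenvector whose quadratic form is
   [d 0 i]. *)
- move=> i; have := Apos (col i (P^t*)).
  have -> : (col i (P^t*))^t* = row i P.
    by apply/matrixP => x y; rewrite !mxE conjCK.
  have -> : (row i P *m A *m col i (P^t*)) 0 0 = (P *m A *m P^t*) i i.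
    by rewrite -row_mul !mxE; apply: eq_bigr => j _; rewrite !mxE.
  by rewrite PAP mxE eqxx mulr1n.
- rewrite -mxtrace_diag -PAP mxtrace_mulC mulmxA -invmx_unitary //.
  by rewrite mulVmx // mul1mx.
apply: prod_XsubC_eq; rewrite -char_poly_eigenvalues.
have -> : char_poly A = char_poly (diag_mx d).
  by rewrite A_E char_poly_conj.
rewrite char_poly_trig ?diag_mx_is_trig // big_map big_enum /=.
by apply: eq_bigr => i _; rewrite !mxE eqxx.
Qed.

(** With [b] the weight outside [i0], [1 - (1 - b)^2 = 2b - b^2 <= 2b]; the other squares only lower
    the left side. *)
Lemma purity_deficit m (r : 'rV[C]_m) i0 :
  (forall i, 0 <= r 0 i) -> \sum_i r 0 i = 1 ->
  1 - \tr (diag_mx r *m diag_mx r) <= (\sum_(i | i != i0) r 0 i) *+ 2.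
Proof.
move=> r_ge0; rewrite mulmx_diag mxtrace_diag (bigD1 i0) //= => /eqP.
rewrite [in X in _ -> X](bigD1 i0) //= mxE.
set a := r 0 i0; set b := \sum_(i | i != i0) r 0 i => /eqP ab1.
set c := \sum_(i | _) _.
have c_ge0 : 0 <= c by apply: sumr_ge0 => i _; rewrite mxE mulr_ge0.
have b_ge0 : 0 <= b by apply: sumr_ge0.
rewrite opprD addrA lerBlDr.
apply: le_trans (_ : b *+ 2 <= _); last by rewrite lerDl.
have -> : 1 - a * a = b *+ 2 - b ^+ 2.
  have -> : a = 1 - b by rewrite -ab1 addrK.
  by ring.
by rewrite gerBl exprn_ge0.
Qed.

(** With [K] eigenvalues below [delta], the counting hypothesis is [m * (n - K) <= n] without
    subtraction: the products with a large bath factor fit into the block of [i0]. *)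
Lemma cooling_unitary m n (i0 : 'I_m) (rhoS : 'M[C]_m) (rhoB : 'M[C]_n)
    (delta : C) :
  density_matrix rhoS -> density_matrix rhoB ->
  (m * n <= n + m * count (fun a : C => (a < delta)%R) (eigenvalues rhoB))%N ->
  exists U : 'M[C]_(m * n), special_unitary U /\
    let rhoS' := ptrace2 (U *m (rhoS *t rhoB) *m U^t*) in
    1 - \tr (rhoS' *m rhoS') <= (delta *+ (m.-1 * n)) *+ 2.
Proof.
move=> dS dB; have [P [p [Pu PE p_ge0 p1 _]]] := density_matrix_spectral dS.
have [Q [q [Qu QE q_ge0 q1 /seq.permP eig]]] := density_matrix_spectral dB.
have -> : count (fun a : C => (a < delta)%R) (eigenvalues rhoB) =
    #|[set k | q 0 k < delta]|.
  by rewrite eig count_map enumT cardsE cardE size_filter.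
move=> le_small.
have n_gt0 : (0 < n)%N.
  case: n q q1 {dB eig Q Qu QE q_ge0 le_small rhoB} => // q.
  by rewrite big_ord0 => /eqP; rewrite eq_sym oner_eq0.
pose w : 'rV[C]_(m * n) :=
  \row_x (p 0 (mxtens_unindex x).1 * q 0 (mxtens_unindex x).2).
pose big := [set x : 'I_(m * n) | ~~ (q 0 (mxtens_unindex x).2 < delta)].
pose ground := [set x : 'I_(m * n) | (mxtens_unindex x).1 == i0].
have card_tens (D : {set 'I_m}) (E : {set 'I_n}) :
    #|[set x : 'I_(m * n) | ((mxtens_unindex x).1 \in D)
                             && ((mxtens_unindex x).2 \in E)]|
    = (#|D| * #|E|)%N.
  rewrite -cardsX -[RHS](card_imset _ (can_inj (@mxtens_indexK m n))).
  apply: eq_card => x; rewrite inE; apply/idP/imsetP => [/andP[Dx Ex]|[[i k] + ->]].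
    by exists (mxtens_unindex x); rewrite ?mxtens_unindexK // inE Dx.
  by rewrite mxtens_indexK inE.
have le_card : (#|big| <= #|ground|)%N.
  have -> : #|ground| = n.
    have := card_tens [set i0] setT; rewrite cards1 mul1n cardsT card_ord.
    by move=> gE; rewrite -[RHS]gE; apply: eq_card => x; rewrite !inE andbT.
  have -> : #|big| = (m * #|[set k : 'I_n | ~~ (q 0%R k < delta)%R]|)%N.
    have := card_tens setT [set k | ~~ (q 0 k < delta)].
    rewrite cardsT card_ord => <-.
    by apply: eq_card => x; rewrite !inE.
  have -> : [set k | ~~ (q 0 k < delta)] = ~: [set k | q 0 k < delta].
    by apply/setP => k; rewrite !inE.
  (* Adding the small products to both sides completes the left one to [m * n], which gives
     [le_small]. *)
  rewrite -(leq_add2r (m * #|[set k | (q 0%R k < delta)%R]|)) -mulnDr.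
  by rewrite [X in (_ * X <= _)%N]addnC cardsC card_ord.
have [s sP] := perm_subset le_card.
pose V := perm_mx s^-1 *m (P *t Q).
have Vu : V \is unitarymx by rewrite mul_unitarymx ?perm_mx_unitary ?tens_unitarymx.
have mn_gt0 : (0 < m * n)%N by rewrite muln_gt0 n_gt0 (leq_ltn_trans _ (ltn_ord i0)).
have [c c1 sU] := special_unitary_phase mn_gt0 Vu.
exists (c *: V); split=> //; cbv zeta.
rewrite scale_conj_unitary //.
have -> : V *m (rhoS *t rhoB) *m V^t* = diag_mx (\row_x w 0 (s^-1 x)%g).
  rewrite -conj_perm_mx_diag -tens_diag_mx -PE -QE.
  rewrite /V trmx_mul map_mxM trmx_tens map_mxT !mulmxA.
  by rewrite -!tensmx_mul !mulmxA.
rewrite ptrace2_diag.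
set r := \row_i _.
have rE i : r 0 i = \sum_k w 0 (s^-1 (mxtens_index (i, k)))%g.
  by rewrite mxE; apply: eq_bigr => k _; rewrite mxE.
have w_ge0 x : 0 <= w 0 x by rewrite mxE mulr_ge0.
have sum_idx (f : 'I_(m * n) -> C) : \sum_i \sum_k f (mxtens_index (i, k)) = \sum_x f x.
  rewrite pair_big /= (reindex (@mxtens_unindex m n)) /=.
    by apply: eq_bigr => x _; congr (f _); exact: mxtens_unindexK.
  by exists (@mxtens_index m n) => x _; rewrite (mxtens_indexK, mxtens_unindexK).
apply: le_trans (purity_deficit i0 _ _) _.
- by move=> i; rewrite rE sumr_ge0.
- under eq_bigr do rewrite rE.
  rewrite (sum_idx (fun x => w 0 (s^-1 x)%g)).
  have -> : \sum_x w 0 (s^-1 x)%g = \sum_x w 0 x.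
    by rewrite [RHS](reindex_perm s^-1%g).
  rewrite -sum_idx -[RHS]p1; apply: eq_bigr => i _.
  under eq_bigr do rewrite mxE mxtens_indexK /=.
  by rewrite -mulr_sumr q1 mulr1.
rewrite lerMn2r /=.
have p_le1 i : p 0 i <= 1 by rewrite -p1 (bigD1 i) //= lerDl sumr_ge0.
(* Each of the [m.-1 * n] places outside the block of [i0] holds a product of some [p 0 i <= 1] with
   a [q 0 k] below [delta]. *)
apply: le_trans (_ : \sum_(i | i != i0) \sum_(k < n) delta <= _); last first.
  rewrite !sumr_const card_ord.
  by rewrite cardC1 card_ord -mulrnA mulnC.
apply: ler_sum => i ii0; rewrite rE; apply: ler_sum => k _.
(* Otherwise [s] would send [x] into [ground], whereas [s x] has first coordinate [i], different
   from [i0]. *)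
set x := (s^-1 _)%g; have : x \notin big.
  apply/negP => /sP; rewrite /x permKV inE mxtens_indexK /=.
  by rewrite (negPf ii0).
rewrite inE negbK => /ltW; rewrite mxE; apply: le_trans.
by rewrite ler_piMl.
Qed.

End Matrices.

Theorem mainTheorem2 (R : realType) (dS dB : nat)
    (hdS : (2 <= dS)%N) (hdB : (1 <= dB)%N) (eps : R) (heps : 0 < eps)
    (rhoB : 'M[R[i]]_dB) (hrhoB : density_matrix rhoB)
    (hsmall :
      Num.ceil (dB%:R * (dS%:R - 1) / dS%:R : R) <=
      (count (fun a : R[i] => a < (eps / (2 * dB%:R * (dS%:R - 1)))%:C%C)
             (eigenvalues rhoB))%:Z)
    (rhoS : 'M[R[i]]_dS) (hrhoS : density_matrix rhoS) :
  exists U : 'M[R[i]]_(dS * dB),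
    special_unitary U /\
    let rhoS' := ptrace2 (U *m (rhoS *t rhoB) *m U^t*) in
    1 - \tr (rhoS' *m rhoS') <= eps%:C%C.
Proof.
case: dS hdS hsmall rhoS hrhoS => // m m_gt0 + rhoS hrhoS.
set delta := eps / _; set K := count _ _; rewrite ceil_le_int ler_pdivrMr ?ltr0Sn // -pmulrn => leK.
(* With [m.+1] for the system dimension, [leK] reads [dB * m <= K * m.+1]; add [dB] to both
   sides. *)
have le_small : (m.+1 * dB <= dB + m.+1 * K)%N.
  rewrite -(ler_nat R) natrD !natrM; move: leK.
  by lra.
have [U [sU leU]] := cooling_unitary ord0 hrhoS hrhoB le_small.
exists U; split=> //; apply: le_trans leU _ => /=.
rewrite -mulrnA -raddfMn lecR /= -[_ *+ _]mulr_natr /delta.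
rewrite -[m.+1]addn1 !natrD addrK !natrM.
have : 0 < m%:R :> R by rewrite ltr0n.
have : 0 < dB%:R :> R by rewrite ltr0n.
(* The threshold is scaled so that [2 * m * dB * delta] is exactly [eps]. *)
move=> b0 m0; rewrite le_eqVlt; apply/orP; left; apply/eqP; field.
by rewrite !gt_eqF.
Qed.
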